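(* Let $0<|q|<1$, $0<|p|<1$, $|x|<1$, $|y|<1$, and let $a,b,c,d\in\mathbb{C}$ with $p^{c}\neq p^{-n}$ and $q^{d}\ne q^{-n}$ for all integers $n\ge 0$. Then $$\Psi_{1}(q^{a},p^{b};p^{c},q^{d};q,p,x,y)=\frac{(p^{b};p)_{\infty}}{(p^{c};p)_{\infty}}\sum_{s=0}^{\infty}\frac{(p^{c-b};p)_{s}\,p^{bs}}{(p;p)_{s}}\,\Psi_{2}(q^{a};0,q^{d};q,p,x,p^{s}y).$$
   Context: $q,p\in\mathbb{C}$ are two independent bases with $0<|q|<1$, $0<|p|<1$; logarithms of $q$ and $p$ are fixed so that $q^{a}=e^{a\log q}$, $p^{b}=e^{b\log p}$ for complex exponents. $(A;q)_{0}=1$, $(A;q)_{k}=\prod_{r=0}^{k-1}(1-Aq^{r})$ for $k\ge1$, $(A;q)_\infty=\prod_{r\ge0}(1-Aq^r)$ (similarly with base $p$). The bibasic Humbert functions are, for $|x|,|y|<1$ and whenever no denominator factor vanishes, $$\Psi_{1}(q^{a},p^{b};p^{c},q^{d};q,p,x,y)=\sum_{\ell,k=0}^{\infty}\frac{(q^{a};q)_{k+\ell}(p^{b};p)_{\ell}}{(p^{c};p)_{\ell}(q^{d};q)_{k}(q;q)_{k}(p;p)_{\ell}}x^{k}y^{\ell},$$ $$\Psi_{2}(q^{a};p^{b},q^{c};q,p,x,y)=\sum_{\ell,k=0}^{\infty}\frac{(q^{a};q)_{k+\ell}}{(p^{b};p)_{\ell}(q^{c};q)_{k}(q;q)_{k}(p;p)_{\ell}}x^{k}y^{\ell}.$$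 $\Psi_{2}(q^{a};0,q^{d};q,p,x,y)$ means the second series with the parameter $p^{b}$ replaced by $0$ (so $(0;p)_\ell=1$) and $q^c$ replaced by $q^d$.
   Formalization: The series over s can diverge when |p^b| ≥ 1 (e.g. b = 0, x = 0), so the identity is stated whenever that series converges, and its convergence is proved for |p^b| < 1. *)

(* Defs.v *)
From Stdlib Require Import Reals.
From Coquelicot Require Import Coquelicot.

Open Scope C_scope.

Definition Cexp (z : C) : C :=
  (exp (Re z) * cos (Im z), exp (Re z) * sin (Im z))%R.

(* The power base^a, where the base enters through a chosen logarithm. *)
Definition Cpower (log_base a : C) : C := Cexp (a * log_base).

(* (A;q)_k *)
Fixpoint qpoch (A q : C) (k : nat) : C :=
  match k with
  | O => 1
  | S k' => qpoch A q k' * (1 - A * q ^ k')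
  end.

(* Like [Lim_seq] and [Series] over R, the operators below are total: they
   return the limit when it exists and an unspecified value otherwise. *)

Definition C_iota : (C -> Prop) -> C :=
  iota (T := CompleteNormedModule.CompleteSpace _ C_CompleteNormedModule).

(* (A;q)_oo *)
Definition qpoch_inf (A q : C) : C :=
  C_iota (fun l : C => filterlim (qpoch A q) eventually (locally (T := C_UniformSpace) l)).

Definition CSeries (u : nat -> C) : C :=
  C_iota (fun l : C => is_series (K := C_AbsRing) (V := C_NormedModule) u l).

(* Sum of a double series: the limit of the rectangular partial sums as both
   bounds tend to infinity independently. *)
Definition is_double_series (u : nat -> nat -> C) (l : C) : Prop :=
  filterlim
    (fun N : nat * nat =>
       sum_n (fun i => sum_n (fun j => u i j) (snd N)) (fst N) : C)
    (filter_prod eventually eventually) (locally (T := C_UniformSpace) l).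

Definition CDouble_series (u : nat -> nat -> C) : C :=
  C_iota (is_double_series u).

(* The parameters A, B, C', D of the bibasic Humbert functions are the values
   q^a, p^b, ... themselves, so that a parameter may also be 0. *)
Definition Psi1 (A B C' D q p x y : C) : C :=
  CDouble_series (fun l k : nat =>
    qpoch A q (k + l) * qpoch B p l
    / (qpoch C' p l * qpoch D q k * qpoch q q k * qpoch p p l)
    * x ^ k * y ^ l).

Definition Psi2 (A B C' q p x y : C) : C :=
  CDouble_series (fun l k : nat =>
    qpoch A q (k + l)
    / (qpoch B p l * qpoch C' q k * qpoch q q k * qpoch p p l)
    * x ^ k * y ^ l).

(* Main.v *)
(** Summing over [k] first, [Psi1] and [Psi2] become power series
    [sum_l (p^b;p)_l / (p^c;p)_l F_l y^l] and [sum_l F_l z^l] with bounded [F_l].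
    Expanding [(p^(c+l);p)_oo / (p^(b+l);p)_oo] by the q-binomial theorem and
    exchanging the sums over [l] and [s] gives the identity.  When
    [|p^b| >= 1], convergence of the right-hand side alone has to justify both
    steps: either [(p^(c-b);p)_s] vanishes for large [s], or it is bounded away
    from 0, and then convergence forces [F_l y^l = 0] for every [l] with
    [|p^(b+l)| >= 1].  In both cases the double series is dominated by a product
    of geometric series. *)

Require Import Defs.
From Stdlib Require Import Reals Lra Lia.
From Coquelicot Require Import Coquelicot.

Open Scope C_scope.

(** * Limits in the complex plane and evaluation of the total limit operators *)

Notation C_cvg u l := (filterlim u eventually (locally (T := C_UniformSpace) l)).
Notation C_series u l := (is_series (K := C_AbsRing) (V := C_NormedModule) u l).
Notation C_sum u n := (sum_n (G := C_AbelianMonoid) u n).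

Lemma C_filterlim_iff {T : Type} (F : (T -> Prop) -> Prop) {FF : Filter F}
    (f : T -> C) (l : C) :
  filterlim f F (locally (T := C_UniformSpace) l) <->
  forall eps : R, (0 < eps)%R -> F (fun t => (Cmod (f t - l) < eps)%R).
Proof.
  split.
  - intros H eps He.
    exact (proj1 (filterlim_locally_ball_norm (K := C_AbsRing)
             (U := C_NormedModule) f l) H (mkposreal eps He)).
  - intros H. apply (filterlim_locally_ball_norm (K := C_AbsRing)
             (U := C_NormedModule) f l).
    intros eps. exact (H eps (cond_pos eps)).
Qed.

Lemma C_lim_unique (u : nat -> C) (l l' : C) : C_cvg u l -> C_cvg u l' -> l = l'.
Proof.
  exact (filterlim_locally_unique (K := C_AbsRing) (V := C_NormedModule) u l l').
Qed.

Lemma C_lim_mult (u v : nat -> C) (l m : C) :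
  C_cvg u l -> C_cvg v m -> C_cvg (fun n => u n * v n) (l * m).
Proof.
  intros Hu Hv.
  eapply (filterlim_comp_2 u v Cmult); [|exact Hv|
    exact (filterlim_scal (K := C_AbsRing) (V := C_NormedModule) l m)].
  (* [filterlim_scal] takes the scalar factor in the uniform structure of the absolute ring;
     [locally_C] identifies it with the product structure. *)
  intros P HP. apply Hu, locally_C, HP.
Qed.

Lemma Cmod_lim_le (u : nat -> C) (l : C) (M : R) :
  C_cvg u l -> (forall n, (Cmod (u n) <= M)%R) -> (Cmod l <= M)%R.
Proof.
  intros Hl Hu. apply Rnot_lt_le; intros Hlt.
  destruct (proj1 (C_filterlim_iff _ _ _) Hl (Cmod l - M)%R) as [N HN]; [lra|].
  specialize (HN N (le_n N)). specialize (Hu N).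
  pose proof (Cmod_triangle (u N) (- (u N - l))) as Ht.
  replace (u N + - (u N - l)) with l in Ht by ring.
  rewrite Cmod_opp in Ht. lra.
Qed.

Lemma lim_scaled_pow (M r : R) : (0 <= r < 1)%R ->
  is_lim_seq (fun n => M * r ^ n)%R 0.
Proof.
  intros Hr. replace (Finite 0) with (Rbar_mult M 0) by (simpl; f_equal; ring).
  apply is_lim_seq_scal_l, is_lim_seq_geom. rewrite Rabs_pos_eq; lra.
Qed.

Lemma C_lim_of_pow_bound (u : nat -> C) (l : C) (M r : R) : (0 <= r < 1)%R ->
  (forall n, (Cmod (u n - l) <= M * r ^ n)%R) -> C_cvg u l.
Proof.
  intros Hr Hu. apply C_filterlim_iff; [apply eventually_filter|]; intros eps He.
  destruct (proj2 (is_lim_seq_spec _ _) (lim_scaled_pow M r Hr) (mkposreal eps He))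
    as [N HN].
  exists N. intros n Hn. specialize (HN n Hn). simpl in HN.
  rewrite Rminus_0_r in HN. pose proof (Rle_abs (M * r ^ n)). specialize (Hu n). lra.
Qed.

(** Limits are unique, so exhibiting any limit determines the value of the total operator; the two
    lemmas below serve the same purpose. *)
Lemma CSeries_unique (u : nat -> C) (l : C) : C_series u l -> CSeries u = l.
Proof.
  intros H. apply (iota_filterlim_locally (K := C_AbsRing)
    (V := C_CompleteNormedModule) (F := eventually)). exact H.
Qed.

Lemma qpoch_inf_unique (A q l : C) : C_cvg (qpoch A q) l -> qpoch_inf A q = l.
Proof.
  intros H. apply (iota_filterlim_locally (K := C_AbsRing)
    (V := C_CompleteNormedModule) (F := eventually)). exact H.
Qed.

Lemma CDouble_series_unique (u : nat -> nat -> C) (l : C) :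
  is_double_series u l -> CDouble_series u = l.
Proof.
  intros H. apply (iota_filterlim_locally (K := C_AbsRing)
    (V := C_CompleteNormedModule) (F := filter_prod eventually eventually)).
  exact H.
Qed.

Lemma is_double_series_ext (u v : nat -> nat -> C) (S : C) :
  (forall i j, u i j = v i j) -> is_double_series u S -> is_double_series v S.
Proof.
  intros H HS. eapply filterlim_ext; [|exact HS]. intros [n m].
  apply sum_n_ext. intros i. apply sum_n_ext. intros j. apply H.
Qed.

(** * Series dominated by a geometric series *)

Section GeometricBound.

Variables (u : nat -> C) (M r : R).
Hypothesis r01 : (0 <= r < 1)%R.
Hypothesis u_le : forall n, (Cmod (u n) <= M * r ^ n)%R.

Lemma geometric_ex_series : exists l, C_series u l.
Proof.
  apply (ex_series_le (K := C_AbsRing) (V := C_CompleteNormedModule) u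
           (fun n => M * r ^ n)%R u_le).
  apply (ex_series_scal (K := R_AbsRing) (V := R_NormedModule) M).
  apply ex_series_geom. rewrite Rabs_pos_eq; lra.
Qed.

Lemma geometric_sum_le (n : nat) : (Cmod (C_sum u n) <= M / (1 - r))%R.
Proof.
  assert (HM : (0 <= M)%R).
  { pose proof (u_le 0). pose proof (Cmod_ge_0 (u 0)). simpl in *. lra. }
  (* The induction needs the exact finite geometric sum; the bound [M / (1 - r)] alone does not
     carry over to the next step. *)
  assert (H : (Cmod (C_sum u n) <= M * (1 - r ^ S n) / (1 - r))%R).
  { induction n as [|n IH].
    - rewrite sum_O. replace (M * (1 - r ^ 1) / (1 - r))%R with (M * r ^ 0)%R
        by (simpl; field; lra). apply u_le.
    - rewrite sum_Sn.
      eapply Rle_trans; [apply (Cmod_triangle (C_sum u n) (u (S n)))|].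
      replace (M * (1 - r ^ S (S n)) / (1 - r))%R
        with (M * (1 - r ^ S n) / (1 - r) + M * r ^ S n)%R
        by (simpl; field; lra).
      apply Rplus_le_compat; auto. }
  eapply Rle_trans; [exact H|].
  apply Rmult_le_compat_r; [left; apply Rinv_0_lt_compat; lra|].
  pose proof (pow_le r (S n) (proj1 r01)). nra.
Qed.

Lemma geometric_series_le (l : C) : C_series u l -> (Cmod l <= M / (1 - r))%R.
Proof. intros H. exact (Cmod_lim_le _ _ _ H geometric_sum_le). Qed.

End GeometricBound.

Lemma geometric_tail_le (u : nat -> C) (M r : R) (l : C) (n : nat) :
  (0 <= r < 1)%R -> (forall k, (Cmod (u k) <= M * r ^ k)%R) -> C_series u l ->
  (Cmod (C_sum u n - l) <= M * r ^ S n / (1 - r))%R.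
Proof.
  intros Hr Hu Hl.
  rewrite <- Cmod_opp. replace (- (C_sum u n - l)) with (l - C_sum u n) by ring.
  (* The tail is again a geometrically dominated series, now with constant [M * r ^ S n]. *)
  apply (geometric_series_le (fun k => u (S n + k)%nat)); [exact Hr| |].
  - intros k. eapply Rle_trans; [apply Hu|]. rewrite pow_add. apply Req_le; ring.
  - apply (is_series_incr_n (K := C_AbsRing) (V := C_NormedModule)); [lia|].
    simpl pred.
    change (C_series u ((l - C_sum u n) + C_sum u n)).
    replace ((l - C_sum u n) + C_sum u n) with l by ring. exact Hl.
Qed.

(** * Double series dominated by a product of geometric series, and exchange of sums *)

Section DoubleSeries.

Variables (u : nat -> nat -> C) (M r t : R).
Hypothesis r01 : (0 <= r < 1)%R.
Hypothesis t01 : (0 <= t < 1)%R.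
Hypothesis u_le : forall i j, (Cmod (u i j) <= M * r ^ i * t ^ j)%R.

Lemma double_row_le (g : nat -> C) : (forall i, C_series (u i) (g i)) ->
  forall i, (Cmod (g i) <= M / (1 - t) * r ^ i)%R.
Proof.
  intros Hg i.
  replace (M / (1 - t) * r ^ i)%R with (M * r ^ i / (1 - t))%R by (field; lra).
  apply (geometric_series_le (u i)); auto.
Qed.

(** The error of a rectangular sum splits in two: cutting every row at [m] costs at most
    [K t^(m+1)], and keeping only the rows up to [n] costs at most [K r^(n+1)]. The two bounds are
    independent, as the product filter requires. *)
Lemma double_series_of_rows (g : nat -> C) (l : C) :
  (forall i, C_series (u i) (g i)) -> C_series g l -> is_double_series u l.
Proof.
  intros Hg Hl.
  set (K := (M / (1 - r) / (1 - t))%R).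
  assert (Hrect : forall n m, (Cmod (C_sum (fun i => C_sum (u i) m) n - l)
                    <= K * t ^ S m + K * r ^ S n)%R).
  { intros n m.
    replace (C_sum (fun i => C_sum (u i) m) n - l)
      with ((C_sum (fun i => C_sum (u i) m) n - C_sum g n) + (C_sum g n - l)) by ring.
    eapply Rle_trans; [apply Cmod_triangle|]. apply Rplus_le_compat.
    - assert (E : C_sum (fun i => C_sum (u i) m) n - C_sum g n
              = C_sum (fun i => C_sum (u i) m - g i) n).
      { clear. induction n as [|n IH]; [rewrite !sum_O; reflexivity|].
        rewrite !sum_Sn, <- IH.
        change (plus (G := C_AbelianMonoid)) with Cplus. ring. }
      rewrite E.
      replace (K * t ^ S m)%R with (M * t ^ S m / (1 - t) / (1 - r))%R
        by (unfold K; field; lra).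
      apply geometric_sum_le; [exact r01|]. intros i.
      replace (M * t ^ S m / (1 - t) * r ^ i)%R
        with ((M * r ^ i) * t ^ S m / (1 - t))%R by (field; lra).
      apply geometric_tail_le; auto.
    - replace (K * r ^ S n)%R with (M / (1 - t) * r ^ S n / (1 - r))%R
        by (unfold K; field; lra).
      apply geometric_tail_le; auto using double_row_le. }
  apply C_filterlim_iff; [apply filter_prod_filter; apply eventually_filter|].
  intros eps He.
  assert (Hev : forall s, (0 <= s < 1)%R ->
            eventually (fun n => (K * s ^ S n < eps / 2)%R)).
  { intros s Hs.
    assert (He2 : (0 < eps / 2)%R) by lra.
    destruct (proj2 (is_lim_seq_spec _ _) (lim_scaled_pow K s Hs)
                (mkposreal _ He2)) as [N HN].
    exists N. intros n Hn. specialize (HN (S n) ltac:(lia)).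
    cbn [pos] in HN. rewrite Rminus_0_r in HN.
    pose proof (Rle_abs (K * s ^ S n)). lra. }
  refine (Filter_prod _ _ _ _ _ (Hev r r01) (Hev t t01) _).
  intros n m Hn Hm. cbn [fst snd].
  pose proof (Hrect n m) as H.
  change (Cmod (C_sum (fun i => C_sum (u i) m) n - l) < eps)%R. lra.
Qed.

(** Square partial sums suffice to identify the limit, and unlike rectangles they keep their shape
    under transposition. *)
Lemma double_series_diagonal (l : C) : is_double_series u l ->
  C_cvg (fun n => C_sum (fun i => C_sum (u i) n) n) l.
Proof.
  intros H. apply C_filterlim_iff; [apply eventually_filter|]; intros eps He.
  assert (FF : Filter (filter_prod eventually eventually))
    by (apply filter_prod_filter; apply eventually_filter).
  destruct (proj1 (C_filterlim_iff _ _ _) H eps He) as [P Q [N HN] [N' HN'] HPQ].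
  exists (max N N'). intros n Hn. apply (HPQ n n); [apply HN|apply HN']; lia.
Qed.

End DoubleSeries.

(** Both iterated sums are limits of the same square partial sums, in which the two finite sums may
    be exchanged. The column sums [h] are summable because they inherit the bound in [t]. *)
Lemma series_fubini (u : nat -> nat -> C) (M r t : R) (g h : nat -> C) (l : C) :
  (0 <= r < 1)%R -> (0 <= t < 1)%R ->
  (forall i j, (Cmod (u i j) <= M * r ^ i * t ^ j)%R) ->
  (forall i, C_series (u i) (g i)) ->
  (forall j, C_series (fun i => u i j) (h j)) ->
  C_series g l -> C_series h l.
Proof.
  intros Hr Ht Hu Hg Hh Hl.
  assert (Hu' : forall j i, (Cmod (u i j) <= M * t ^ j * r ^ i)%R).
  { intros j i. eapply Rle_trans; [apply Hu|apply Req_le; ring]. }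
  destruct (geometric_ex_series h (M / (1 - r)) t Ht) as [l' Hl'].
  { exact (double_row_le (fun j i => u i j) M t r Hr Hu' h Hh). }
  replace l with l'; [exact Hl'|].
  pose proof (double_series_diagonal _ _
    (double_series_of_rows u M r t Hr Ht Hu g l Hg Hl)) as H1.
  pose proof (double_series_diagonal _ _
    (double_series_of_rows (fun j i => u i j) M t r Ht Hr Hu' h l' Hh Hl')) as H2.
  eapply C_lim_unique; [exact H2|].
  eapply filterlim_ext; [|exact H1].
  intros n. exact (sum_n_switch (G := C_AbelianMonoid) u n n).
Qed.

(** * Bounds, convergence and nonvanishing of Pochhammer symbols *)

Lemma Cmod_mult_pow (A q : C) (n : nat) :
  Cmod (A * q ^ n) = (Cmod A * Cmod q ^ n)%R.
Proof. rewrite Cmod_mult, Cmod_pow. reflexivity. Qed.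

Lemma Cmod_one_minus_ge (z : C) : (1 - Cmod z <= Cmod (1 - z))%R.
Proof.
  pose proof (Cmod_triangle (1 - z) z) as H.
  replace (1 - z + z) with (RtoC 1) in H by ring. rewrite Cmod_1 in H. lra.
Qed.

Lemma qpoch_add (A q : C) (n m : nat) :
  qpoch A q (n + m) = qpoch A q n * qpoch (A * q ^ n) q m.
Proof.
  induction m as [|m IH].
  - rewrite Nat.add_0_r. simpl. ring.
  - rewrite Nat.add_succ_r. simpl. rewrite IH, Cpow_add_r. ring.
Qed.

Lemma qpoch_zero (q : C) (n : nat) : qpoch 0 q n = 1.
Proof. induction n as [|n IH]; simpl; [reflexivity|rewrite IH; ring]. Qed.

Lemma qpoch_eq_zero_above (A q : C) (n m : nat) :
  A * q ^ n = 1 -> (n < m)%nat -> qpoch A q m = 0.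
Proof.
  intros H Hm. replace m with (S n + (m - S n))%nat by lia.
  rewrite qpoch_add. simpl. rewrite H. ring.
Qed.

Section QPochBounds.

Variable q : C.
Hypothesis q_lt_1 : (Cmod q < 1)%R.

(** Each factor satisfies [|1 - A q^k| <= 1 + |A||q|^k <= exp(|A||q|^k)], and the exponents form a
    geometric sum. *)
Lemma qpoch_upper (A : C) (n : nat) :
  (Cmod (qpoch A q n) <= exp (Cmod A / (1 - Cmod q)))%R.
Proof.
  pose proof (Cmod_ge_0 q) as Hq. pose proof (Cmod_ge_0 A) as HA.
  assert (H : (Cmod (qpoch A q n)
               <= exp (Cmod A * (1 - Cmod q ^ n) / (1 - Cmod q)))%R).
  { induction n as [|n IH].
    - simpl qpoch. rewrite Cmod_1.
      replace (Cmod A * (1 - Cmod q ^ 0) / (1 - Cmod q))%R with 0%R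
        by (simpl; field; lra).
      rewrite exp_0. lra.
    - simpl qpoch. rewrite Cmod_mult.
      replace (Cmod A * (1 - Cmod q ^ S n) / (1 - Cmod q))%R
        with (Cmod A * (1 - Cmod q ^ n) / (1 - Cmod q) + Cmod A * Cmod q ^ n)%R
        by (simpl; field; lra).
      rewrite exp_plus. apply Rmult_le_compat; try apply Cmod_ge_0; [exact IH|].
      eapply Rle_trans; [|apply exp_ineq1_le].
      eapply Rle_trans; [apply Cmod_triangle|].
      rewrite Cmod_opp, Cmod_1, Cmod_mult_pow. lra. }
  eapply Rle_trans; [exact H|].
  assert (Hle : (Cmod A * (1 - Cmod q ^ n) / (1 - Cmod q)
                 <= Cmod A / (1 - Cmod q))%R).
  { apply Rmult_le_compat_r; [left; apply Rinv_0_lt_compat; lra|].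
    pose proof (pow_le (Cmod q) n Hq). nra. }
  destruct Hle as [Hlt|Heq]; [left; apply exp_increasing, Hlt|rewrite Heq; lra].
Qed.

(** The symbols are the partial sums of their consecutive differences [-(A;q)_k A q^k], which decay
    geometrically by [qpoch_upper]. *)
Lemma qpoch_lim (A : C) : C_cvg (qpoch A q) (qpoch_inf A q).
Proof.
  pose proof (Cmod_ge_0 q) as Hq.
  set (u := fun n => match n with
                     | O => RtoC 1
                     | S k => - (qpoch A q k * (A * q ^ k))
                     end).
  assert (Hsum : forall n, C_sum u n = qpoch A q n).
  { induction n as [|n IH]; [rewrite sum_O; reflexivity|].
    rewrite sum_Sn, IH.
    change (qpoch A q n + u (S n) = qpoch A q (S n)). simpl. ring. }
  assert (Hex : ex_series (K := C_AbsRing) (V := C_NormedModule) u).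
  { apply (ex_series_incr_1 (K := C_AbsRing) (V := C_NormedModule)).
    apply (geometric_ex_series (fun k => u (S k))
             (exp (Cmod A / (1 - Cmod q)) * Cmod A) (Cmod q)); [lra|].
    intros n. simpl. rewrite Cmod_opp, Cmod_mult, Cmod_mult_pow.
    rewrite Rmult_assoc. apply Rmult_le_compat_r; [|apply qpoch_upper].
    apply Rmult_le_pos; [apply Cmod_ge_0|apply pow_le, Hq]. }
  destruct Hex as [l Hl].
  assert (Hlim : C_cvg (qpoch A q) l).
  { eapply filterlim_ext; [|exact Hl]. exact Hsum. }
  rewrite (qpoch_inf_unique A q l Hlim). exact Hlim.
Qed.

Lemma qpoch_inf_add (A : C) (n : nat) :
  qpoch_inf A q = qpoch A q n * qpoch_inf (A * q ^ n) q.
Proof.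
  apply (C_lim_unique (fun m => qpoch A q (n + m))).
  - intros P HP. destruct (qpoch_lim A P HP) as [N HN].
    exists N. intros m Hm. apply HN. lia.
  - eapply filterlim_ext.
    { intros m. symmetry. apply qpoch_add. }
    apply C_lim_mult; [apply filterlim_const|apply qpoch_lim].
Qed.

(** For [|A| <= (1 - |q|)/2] the product is at least [1 - sum_k |A||q|^k >= 1/2]. For general [A],
    nonzero factors are split off one at a time until [A q^N] is that small. *)
Lemma qpoch_lower (A : C) : (forall n, A * q ^ n <> 1) ->
  exists c : R, (0 < c)%R /\ forall n, (c <= Cmod (qpoch A q n))%R.
Proof.
  pose proof (Cmod_ge_0 q) as Hq.
  assert (Hsmall : forall A, (Cmod A <= (1 - Cmod q) / 2)%R ->
            forall n, (1 / 2 <= Cmod (qpoch A q n))%R).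
  { clear A. intros A HA n. pose proof (Cmod_ge_0 A) as HA0.
    assert (H : (1 - Cmod A * (1 - Cmod q ^ n) / (1 - Cmod q)
                 <= Cmod (qpoch A q n))%R /\
                (0 <= 1 - Cmod A * (1 - Cmod q ^ n) / (1 - Cmod q) - 1 / 2)%R).
    { split.
      2:{ pose proof (pow_le (Cmod q) n Hq).
          assert (Cmod A * (1 - Cmod q ^ n) / (1 - Cmod q) <= 1 / 2)%R; [|lra].
          apply (Rmult_le_reg_r (1 - Cmod q)); [lra|].
          unfold Rdiv at 1. rewrite Rmult_assoc, Rinv_l by lra. nra. }
      induction n as [|n IH].
      - simpl qpoch. rewrite Cmod_1. apply Req_le. simpl. field. lra.
      - simpl qpoch. rewrite Cmod_mult.
        pose proof (Cmod_one_minus_ge (A * q ^ n)) as H1.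
        rewrite Cmod_mult_pow in H1.
        replace (Cmod A * (1 - Cmod q ^ S n) / (1 - Cmod q))%R
          with (Cmod A * (1 - Cmod q ^ n) / (1 - Cmod q) + Cmod A * Cmod q ^ n)%R
          by (simpl; field; lra).
        assert (Hd : (0 <= Cmod A * Cmod q ^ n <= 1)%R).
        { assert (0 <= Cmod q ^ n <= 1)%R; [|split; nra].
          split; [apply pow_le, Hq|].
          rewrite <- (pow1 n). apply pow_incr. lra. }
        assert (He : (0 <= Cmod A * (1 - Cmod q ^ n) / (1 - Cmod q))%R).
        { apply Rmult_le_pos; [|left; apply Rinv_0_lt_compat; lra].
          apply Rmult_le_pos; [exact HA0|].
          pose proof (pow_incr (Cmod q) 1 n). rewrite pow1 in H. lra. }
        pose proof (Cmod_ge_0 (qpoch A q n)).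
        (* Weierstrass product inequality: [(1 - e)(1 - d) >= 1 - (e + d)] for nonnegative [e] and
           [d]; [d <= 1] keeps the new factor's lower bound nonnegative. *)
        set (e := (Cmod A * (1 - Cmod q ^ n) / (1 - Cmod q))%R) in *.
        set (d := (Cmod A * Cmod q ^ n)%R) in *. nra. }
    lra. }
  assert (Hind : forall N A, (Cmod A * Cmod q ^ N <= (1 - Cmod q) / 2)%R ->
            (forall n, A * q ^ n <> 1) ->
            exists c : R, (0 < c)%R /\ forall n, (c <= Cmod (qpoch A q n))%R).
  { clear A. induction N as [|N IH]; intros A HA Hne.
    - exists (1 / 2)%R. split; [lra|]. apply Hsmall. simpl in HA. lra.
    - destruct (IH (A * q)) as [c [Hc Hcn]].
      + rewrite Cmod_mult. simpl in HA. lra.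
      + intros n. specialize (Hne (S n)). simpl in Hne. rewrite <- Cmult_assoc.
        exact Hne.
      + assert (H1 : (0 < Cmod (1 - A))%R).
        { apply Cmod_gt_0. intros H0. apply (Hne O). simpl.
          replace A with (1 - (1 - A)) by ring. rewrite H0. ring. }
        (* The value 1 covers the empty product, from which no first factor can be split off. *)
        exists (Rmin 1 (Cmod (1 - A) * c)). split.
        { apply Rmin_glb_lt; [lra|]. apply Rmult_lt_0_compat; lra. }
        intros [|n]; [simpl; rewrite Cmod_1; apply Rmin_l|].
        eapply Rle_trans; [apply Rmin_r|].
        change (S n) with (1 + n)%nat. rewrite qpoch_add, Cmod_mult. simpl.
        replace (1 * (1 - A * 1)) with (1 - A) by ring. rewrite Cmult_1_r.
        apply Rmult_le_compat_l; [lra|apply Hcn]. }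
  intros Hne.
  assert (H2 : (0 < (1 - Cmod q) / 2)%R) by lra.
  destruct (proj2 (is_lim_seq_spec _ _) (lim_scaled_pow (Cmod A) (Cmod q)
    (conj Hq q_lt_1)) (mkposreal _ H2)) as [N HN].
  apply (Hind N); [|exact Hne].
  specialize (HN N (le_n N)). cbn [pos] in HN. rewrite Rminus_0_r in HN.
  pose proof (Rle_abs (Cmod A * Cmod q ^ N)). lra.
Qed.

(** This is the nonvanishing condition for the denominators [(q;q)_n]: all positive powers of [q]
    lie inside the unit disc. *)
Lemma Cmult_pow_neq_1 (n : nat) : q * q ^ n <> 1.
Proof.
  intros H. apply (f_equal Cmod) in H. rewrite Cmod_mult_pow, Cmod_1 in H.
  pose proof (Cmod_ge_0 q).
  assert (Cmod q ^ n <= 1)%R by (rewrite <- (pow1 n); apply pow_incr; lra).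
  pose proof (pow_le (Cmod q) n). nra.
Qed.

Lemma qpoch_neq_0 (A : C) : (forall n, A * q ^ n <> 1) ->
  forall n, qpoch A q n <> 0.
Proof.
  intros H n H0. destruct (qpoch_lower A H) as [c [Hc Hcn]].
  specialize (Hcn n). rewrite H0, Cmod_0 in Hcn. lra.
Qed.

Lemma qpoch_inf_neq_0 (A : C) : (forall n, A * q ^ n <> 1) -> qpoch_inf A q <> 0.
Proof.
  intros H H0. destruct (qpoch_lower A H) as [c [Hc Hcn]].
  pose proof (qpoch_lim A) as Hlim. rewrite H0 in Hlim.
  destruct (proj1 (C_filterlim_iff _ _ _) Hlim c Hc) as [N HN].
  specialize (HN N (le_n N)). specialize (Hcn N).
  replace (qpoch A q N - 0) with (qpoch A q N) in HN by ring. lra.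
Qed.

Lemma qpoch_inv_le (A : C) : (forall n, A * q ^ n <> 1) ->
  exists K : R, (0 <= K)%R /\ forall n, (Cmod (/ qpoch A q n) <= K)%R.
Proof.
  intros H. destruct (qpoch_lower A H) as [c [Hc Hcn]].
  exists (/ c)%R. split; [left; apply Rinv_0_lt_compat, Hc|]. intros n.
  rewrite Cmod_inv by (apply qpoch_neq_0, H).
  apply Rinv_le_contravar; auto.
Qed.

End QPochBounds.

(** * The q-binomial theorem in base [p] *)

(** The coefficient of [z^s] in the basic hypergeometric series 1phi0 with numerator parameter [a]
    and base [p]. *)
Definition qbin (a p : C) (s : nat) : C := qpoch a p s / qpoch p p s.

Section QBinomial.

Variables a p : C.
Hypothesis p_lt_1 : (Cmod p < 1)%R.

Lemma qbin_succ (s : nat) :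
  qbin a p (S s) * (1 - p ^ S s) = qbin a p s * (1 - a * p ^ s).
Proof.
  unfold qbin. simpl.
  pose proof (qpoch_neq_0 p p_lt_1 p (Cmult_pow_neq_1 p p_lt_1) s).
  assert (1 - p * p ^ s <> 0).
  { intros H0. apply (Cmult_pow_neq_1 p p_lt_1 s).
    replace (p * p ^ s) with (1 - (1 - p * p ^ s)) by ring. rewrite H0. ring. }
  field. auto.
Qed.

Lemma qbin_upper : exists W, (0 <= W)%R /\ forall s, (Cmod (qbin a p s) <= W)%R.
Proof.
  destruct (qpoch_inv_le p p_lt_1 p (Cmult_pow_neq_1 p p_lt_1)) as [K [HK Hs]].
  exists (exp (Cmod a / (1 - Cmod p)) * K)%R. split.
  { apply Rmult_le_pos; [left; apply exp_pos|exact HK]. }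
  intros s. unfold qbin, Cdiv. rewrite Cmod_mult.
  apply Rmult_le_compat; try apply Cmod_ge_0; auto using qpoch_upper.
Qed.

(** If [a p^N = 1], the factor of index [N] kills all later coefficients. Otherwise the numerator
    stays away from 0 by [qpoch_lower], while the denominator is bounded by [qpoch_upper]. *)
Lemma qbin_dichotomy :
  (exists N, forall s, (N < s)%nat -> qbin a p s = 0) \/
  (exists c, (0 < c)%R /\ forall s, (c <= Cmod (qbin a p s))%R).
Proof.
  destruct (Classical_Prop.classic (exists N, a * p ^ N = 1)) as [[N HN]|H].
  - left. exists N. intros s Hs. unfold qbin.
    rewrite (qpoch_eq_zero_above a p N s HN Hs). unfold Cdiv. ring.
  - right. destruct (qpoch_lower p p_lt_1 a) as [c [Hc Hcn]].
    { intros n Hn. apply H. exists n. exact Hn. }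
    set (E := exp (Cmod p / (1 - Cmod p))).
    assert (HE : (0 < E)%R) by apply exp_pos.
    exists (c / E)%R. split; [apply Rdiv_lt_0_compat; auto|]. intros s.
    pose proof (qpoch_neq_0 p p_lt_1 p (Cmult_pow_neq_1 p p_lt_1) s) as Hp.
    unfold qbin. rewrite Cmod_div by exact Hp.
    apply Rmult_le_compat; [lra|left; apply Rinv_0_lt_compat, HE|apply Hcn|].
    apply Rinv_le_contravar; [apply Cmod_gt_0, Hp|apply qpoch_upper, p_lt_1].
Qed.

(** The difference [h(z) - h(pz)] has coefficients [qbin a p s * (1 - p^s)]; after a shift of index,
    [qbin_succ] turns it into [z (h(z) - a h(pz))]. *)
Lemma q_binomial_functional (z h h' : C) :
  C_series (fun s => qbin a p s * z ^ s) h ->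
  C_series (fun s => qbin a p s * (p * z) ^ s) h' ->
  (1 - z) * h = (1 - a * z) * h'.
Proof.
  intros Hh Hh'.
  set (v := fun s => qbin a p s * (1 - p ^ s) * z ^ s).
  assert (H1 : C_series v (h - h')).
  { eapply is_series_ext;
      [|exact (is_series_minus (K := C_AbsRing) (V := C_NormedModule) _ _ _ _ Hh Hh')].
    intros s. unfold v.
    change (qbin a p s * z ^ s - qbin a p s * (p * z) ^ s
            = qbin a p s * (1 - p ^ s) * z ^ s).
    rewrite Cpow_mult_l. ring. }
  (* The term of index 0 vanishes since [1 - p^0 = 0], so the shift leaves the sum unchanged. *)
  assert (H2 : C_series (fun s => v (S s)) (h - h')).
  { apply (is_series_incr_1 (K := C_AbsRing) (V := C_NormedModule)).
    change (C_series v ((h - h') + v O)).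
    replace (h - h' + v O) with (h - h'); [exact H1|]. unfold v. simpl. ring. }
  assert (H3 : C_series (fun s => v (S s)) (z * (h - a * h'))).
  { eapply is_series_ext;
      [|exact (is_series_scal (K := C_AbsRing) (V := C_NormedModule) z _ _
         (is_series_minus (K := C_AbsRing) (V := C_NormedModule) _ _ _ _ Hh
           (is_series_scal (K := C_AbsRing) (V := C_NormedModule) a _ _ Hh')))].
    intros s. unfold v. rewrite qbin_succ.
    change (z * (qbin a p s * z ^ s - a * (qbin a p s * (p * z) ^ s))
            = qbin a p s * (1 - a * p ^ s) * z ^ S s).
    rewrite Cpow_mult_l. simpl. ring. }
  assert (H4 : h - h' = z * (h - a * h')) by exact (C_lim_unique _ _ _ H2 H3).
  replace ((1 - z) * h) with ((h - h') - z * h + h') by ring. rewrite H4. ring.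
Qed.

(* No condition on [|z|]: when [a = p^(-N)] the series terminates and the
   geometric bound holds for every [z]. *)
Lemma q_binomial (z : C) (M r : R) : (0 <= r < 1)%R ->
  (forall s, (Cmod (qbin a p s * z ^ s) <= M * r ^ s)%R) ->
  exists h, C_series (fun s => qbin a p s * z ^ s) h /\
    qpoch_inf z p * h = qpoch_inf (a * z) p.
Proof.
  intros Hr Hz. pose proof (Cmod_ge_0 p) as Hp0.
  assert (HM : (0 <= M)%R).
  { pose proof (Hz O). pose proof (Cmod_ge_0 (qbin a p O * z ^ O)). simpl in *. lra. }
  set (T := fun n s => qbin a p s * (p ^ n * z) ^ s).
  (* Replacing [z] by [p^n z] gains [|p|^(sn)], which will suppress every term except the one with
     [s = 0]. *)
  assert (HT : forall n s, (Cmod (T n s) <= M * r ^ s * (Cmod p ^ s) ^ n)%R).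
  { intros n s. unfold T. rewrite Cpow_mult_l.
    replace (qbin a p s * ((p ^ n) ^ s * z ^ s))
      with (qbin a p s * z ^ s * (p ^ n) ^ s) by ring.
    rewrite Cmod_mult, !Cmod_pow, <- !pow_mult, Nat.mul_comm.
    apply Rmult_le_compat_r; [apply pow_le, Hp0|apply Hz]. }
  assert (HT0 : forall n s, (Cmod (T n s) <= M * r ^ s)%R).
  { intros n s. eapply Rle_trans; [apply HT|].
    rewrite <- Rmult_1_r. apply Rmult_le_compat_l.
    { apply Rmult_le_pos; [exact HM|apply pow_le; lra]. }
    rewrite <- pow_mult, <- (pow1 (s * n)). apply pow_incr. lra. }
  assert (Hex : forall n, exists l, C_series (T n) l)
    by (intros n; exact (geometric_ex_series (T n) M r Hr (HT0 n))).
  set (H := fun n => CSeries (T n)).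
  assert (HH : forall n, C_series (T n) (H n)).
  { intros n. destruct (Hex n) as [l Hl]. unfold H.
    rewrite (CSeries_unique _ _ Hl). exact Hl. }
  assert (HT00 : C_series (fun s => qbin a p s * z ^ s) (H O)).
  { eapply is_series_ext; [|exact (HH O)]. intros s. unfold T.
    rewrite Cmult_1_l. reflexivity. }
  exists (H O). split; [exact HT00|].
  (* The functional equation, iterated [n] times along [z], [p z], [p^2 z] and so on. *)
  assert (Hiter : forall n, qpoch z p n * H O = qpoch (a * z) p n * H n).
  { induction n as [|n IH]; [simpl; ring|].
    pose proof (q_binomial_functional (p ^ n * z) (H n) (H (S n)) (HH n)) as Hf.
    rewrite Cmult_assoc in Hf. specialize (Hf (HH (S n))).
    simpl qpoch.
    replace (qpoch z p n * (1 - z * p ^ n) * H O)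
      with ((1 - p ^ n * z) * (qpoch z p n * H O)) by ring.
    rewrite IH.
    replace ((1 - p ^ n * z) * (qpoch (a * z) p n * H n))
      with (qpoch (a * z) p n * ((1 - p ^ n * z) * H n)) by ring.
    rewrite Hf. ring. }
  (* The term [s = 0] equals 1 and the rest is [O(|p|^n)], so letting [n] grow in [Hiter] leaves the
     infinite products. *)
  assert (Hlim : C_cvg H (RtoC 1)).
  { apply (C_lim_of_pow_bound _ _ (M / (1 - r)) (Cmod p)); [lra|]. intros n.
    replace (M / (1 - r) * Cmod p ^ n)%R with (M * Cmod p ^ n / (1 - r))%R
      by (field; lra).
    apply (geometric_series_le (fun s => T n (S s)) _ r Hr).
    - intros s. eapply Rle_trans; [apply HT|].
      rewrite <- pow_mult, Nat.mul_comm.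
      pose proof (pow_le r s (proj1 Hr)) as Hrs.
      pose proof (pow_le (Cmod p) n Hp0) as Hpn.
      replace (n * S s)%nat with (n + n * s)%nat by lia. rewrite pow_add. simpl pow.
      assert (Hps : (0 <= Cmod p ^ (n * s) <= 1)%R).
      { split; [apply pow_le, Hp0|]. rewrite <- (pow1 (n * s)). apply pow_incr. lra. }
      replace (M * (r * r ^ s) * (Cmod p ^ n * Cmod p ^ (n * s)))%R
        with (M * Cmod p ^ n * r ^ s * (r * Cmod p ^ (n * s)))%R by ring.
      rewrite <- Rmult_1_r. apply Rmult_le_compat_l; [|nra].
      apply Rmult_le_pos; [apply Rmult_le_pos|]; auto.
    - apply (is_series_incr_1 (K := C_AbsRing) (V := C_NormedModule)).
      change (C_series (T n) (H n - 1 + T n O)).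
      replace (H n - 1 + T n O) with (H n); [apply HH|].
      unfold T, qbin. simpl. field. }
  apply (C_lim_unique (fun n => qpoch z p n * H O)).
  - apply C_lim_mult; [apply qpoch_lim, p_lt_1|apply filterlim_const].
  - eapply filterlim_ext.
    { intros n. symmetry. apply Hiter. }
    replace (qpoch_inf (a * z) p) with (qpoch_inf (a * z) p * 1) by ring.
    apply C_lim_mult; [apply qpoch_lim, p_lt_1|exact Hlim].
Qed.

End QBinomial.

(** * Summability forced by convergence of the right-hand side, and the resulting transformation of
    power series *)

Lemma C_series_drop_zeros (u : nat -> C) (l : C) (m : nat) :
  (forall j, (j < m)%nat -> u j = 0) -> C_series u l ->
  C_series (fun k => u (m + k)%nat) l.
Proof.
  induction m as [|m IH]; intros Hz Hl; [exact Hl|].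
  assert (H : C_series (fun k => u (m + S k)%nat) l).
  { apply (is_series_incr_1 (K := C_AbsRing) (V := C_NormedModule)
             (fun k => u (m + k)%nat)).
    change (C_series (fun k => u (m + k)%nat) (l + u (m + 0)%nat)).
    rewrite Hz by lia. replace (l + 0) with l by ring. apply IH; auto. }
  eapply is_series_ext; [|exact H]. intros k. simpl. f_equal. lia.
Qed.

Lemma C_series_terms_cvg_0 (u : nat -> C) (l : C) :
  C_series u l -> forall eps, (0 < eps)%R ->
  eventually (fun n => (Cmod (u n) < eps)%R).
Proof.
  intros Hl eps He.
  destruct (Cauchy_ex_series (K := C_AbsRing) (V := C_CompleteNormedModule) u
              (ex_intro _ l Hl) (mkposreal eps He)) as [N HN].
  exists N. intros n Hn. specialize (HN n n Hn Hn). rewrite sum_n_n in HN. exact HN.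
Qed.

Lemma finite_max (v : nat -> R) (N : nat) :
  exists K, (0 <= K)%R /\ forall s, (s <= N)%nat -> (v s <= K)%R.
Proof.
  induction N as [|N [K [HK HN]]].
  - exists (Rmax 0 (v O)). split; [apply Rmax_l|]. intros s Hs.
    replace s with O by lia. apply Rmax_r.
  - exists (Rmax K (v (S N))). split; [eapply Rle_trans; [exact HK|apply Rmax_l]|].
    intros s Hs. destruct (Nat.eq_dec s (S N)) as [->|Hne]; [apply Rmax_r|].
    eapply Rle_trans; [apply HN; lia|apply Rmax_l].
Qed.

Section Summability.

(** In the application [f n] is the [n]-th Humbert coefficient times [y^n], [w] is [qbin], [B] is
    [p^b], and [F s] is the value of [Psi2] at [p^s y]. *)
Variables (f w F : nat -> C) (B p l : C) (M t W : R).
Hypothesis t01 : (0 <= t < 1)%R.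
Hypothesis p01 : (0 < Cmod p < 1)%R.
Hypothesis f_le : forall n, (Cmod (f n) <= M * t ^ n)%R.
Hypothesis w_le : forall s, (Cmod (w s) <= W)%R.
Hypothesis F_series : forall s, C_series (fun n => f n * (p ^ s) ^ n) (F s).
Hypothesis term_series : C_series (fun s => w s * B ^ s * F s) l.

Let M_ge_0 : (0 <= M)%R.
Proof. pose proof (f_le O). pose proof (Cmod_ge_0 (f O)). simpl in *. lra. Qed.

Let p_pow_le_1 (n : nat) : (0 <= Cmod p ^ n <= 1)%R.
Proof.
  split; [apply pow_le; lra|]. rewrite <- (pow1 n). apply pow_incr. lra.
Qed.

(** Every term beyond the [m]-th carries at least one more factor [p^s]; what remains is dominated
    by a geometric series in [t]. *)
Lemma leading_term_approx (m s : nat) : (forall j, (j < m)%nat -> f j = 0) ->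
  (Cmod (F s - f m * (p ^ s) ^ m) <= M * (Cmod p ^ m) ^ s * Cmod p ^ s / (1 - t))%R.
Proof.
  intros Hz. set (u := fun n => f n * (p ^ s) ^ n).
  assert (H : C_series (fun k => u (m + k)%nat) (F s)).
  { apply C_series_drop_zeros; [|apply F_series]. intros j Hj. unfold u.
    rewrite Hz by exact Hj. ring. }
  apply (geometric_series_le (fun k => u (m + S k)%nat) _ t t01).
  - intros k. unfold u. rewrite Cmod_mult, !Cmod_pow, <- !pow_mult.
    (* The factors [|p|^(ms)] and [|p|^s] are kept for the bound; [|p|^(sk)] is estimated by 1. *)
    replace (s * (m + S k))%nat with (m * s + s + s * k)%nat by lia.
    rewrite !pow_add.
    pose proof (p_pow_le_1 (m * s)). pose proof (p_pow_le_1 s).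
    pose proof (p_pow_le_1 (s * k)).
    assert (Hf : (Cmod (f (m + S k)%nat) <= M * t ^ k)%R).
    { eapply Rle_trans; [apply f_le|]. apply Rmult_le_compat_l; [exact M_ge_0|].
      replace (m + S k)%nat with (k + S m)%nat by lia. rewrite pow_add.
      pose proof (pow_le t k (proj1 t01)).
      assert (t ^ S m <= 1)%R by (rewrite <- (pow1 (S m)); apply pow_incr; lra).
      nra. }
    replace (M * Cmod p ^ (m * s) * Cmod p ^ s * t ^ k)%R
      with (M * t ^ k * (Cmod p ^ (m * s) * Cmod p ^ s * 1))%R by ring.
    assert (0 <= Cmod p ^ (m * s) * Cmod p ^ s)%R by (apply Rmult_le_pos; lra).
    apply Rmult_le_compat; [apply Cmod_ge_0| |exact Hf|].
    + apply Rmult_le_pos; lra.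
    + apply Rmult_le_compat_l; lra.
  - apply (is_series_incr_1 (K := C_AbsRing) (V := C_NormedModule)
             (fun k => u (m + k)%nat)).
    change (C_series (fun k => u (m + k)%nat)
              (F s - f m * (p ^ s) ^ m + u (m + 0)%nat)).
    rewrite Nat.add_0_r. unfold u at 2.
    replace (F s - f m * (p ^ s) ^ m + f m * (p ^ s) ^ m) with (F s) by ring.
    exact H.
Qed.

(* If [f m] is the first nonzero coefficient, the [s]-th term is
   [w s * (B p^m)^s * (f m + O(p^s))], which cannot tend to 0 when
   [|B p^m| >= 1]. *)
Lemma leading_coef_zero (c : R) (m : nat) : (0 < c)%R ->
  (forall s, (c <= Cmod (w s))%R) -> (forall j, (j < m)%nat -> f j = 0) ->
  (1 <= Cmod (B * p ^ m))%R -> f m = 0.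
Proof.
  intros Hc Hw Hz HB. apply Cmod_eq_0.
  apply Rle_antisym; [|apply Cmod_ge_0]. apply le_epsilon. intros eps He.
  rewrite Rplus_0_l.
  (* The factor [c] in the tolerance cancels against the lower bound of [|w s|], leaving
     [eps / 2]. *)
  destruct (C_series_terms_cvg_0 _ _ term_series (c * (eps / 2))) as [N HN].
  { apply Rmult_lt_0_compat; lra. }
  assert (He2 : (0 < eps / 2)%R) by lra.
  assert (Hp1 : (0 <= Cmod p < 1)%R) by lra.
  destruct (proj2 (is_lim_seq_spec _ _)
    (lim_scaled_pow (M / (1 - t)) (Cmod p) Hp1) (mkposreal _ He2)) as [N' HN'].
  set (s := max N N').
  specialize (HN s ltac:(lia)). specialize (HN' s ltac:(lia)).
  cbn [pos] in HN'. rewrite Rminus_0_r in HN'.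
  pose proof (Rle_abs (M / (1 - t) * Cmod p ^ s)) as Habs.
  pose proof (leading_term_approx m s Hz) as Happ.
  rewrite !Cmod_mult, Cmod_pow in HN.
  rewrite Cmod_mult, Cmod_pow in HB.
  set (P := ((Cmod p ^ m) ^ s)%R) in *.
  assert (HX : (1 <= Cmod B ^ s * P)%R).
  { unfold P. rewrite <- Rpow_mult_distr. apply pow_R1_Rle, HB. }
  assert (HP : (0 <= P)%R) by (apply pow_le, pow_le; lra).
  assert (Hfm : (Cmod (f m) * P <= Cmod (F s) + P * (eps / 2))%R).
  { pose proof (Cmod_triangle (F s) (- (F s - f m * (p ^ s) ^ m))) as Ht.
    replace (F s + - (F s - f m * (p ^ s) ^ m)) with (f m * (p ^ s) ^ m) in Ht by ring.
    rewrite Cmod_opp, Cmod_mult, !Cmod_pow in Ht.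
    replace ((Cmod p ^ s) ^ m)%R with P in Ht
      by (unfold P; rewrite <- !pow_mult, Nat.mul_comm; reflexivity).
    assert (M * P * Cmod p ^ s / (1 - t) <= P * (eps / 2))%R; [|lra].
    replace (M * P * Cmod p ^ s / (1 - t))%R with (P * (M / (1 - t) * Cmod p ^ s))%R
      by (field; lra).
    apply Rmult_le_compat_l; lra. }
  set (b := (Cmod B ^ s)%R) in *.
  assert (Hb : (0 <= b)%R) by (apply pow_le, Cmod_ge_0).
  assert (H1 : (c * (b * Cmod (F s)) < c * (eps / 2))%R).
  { eapply Rle_lt_trans; [|exact HN]. rewrite Rmult_assoc.
    apply Rmult_le_compat_r; [|apply Hw].
    apply Rmult_le_pos; [exact Hb|apply Cmod_ge_0]. }
  apply Rmult_lt_reg_l in H1; [|exact Hc].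
  assert (H2 : (b * (Cmod (f m) * P) <= b * (Cmod (F s) + P * (eps / 2)))%R)
    by (apply Rmult_le_compat_l; auto).
  (* Since [b * P >= 1], this inequality bounds [|f m|] by [eps]. *)
  assert (H3 : ((b * P) * (Cmod (f m) - eps / 2) < eps / 2)%R) by nra.
  destruct (Rle_lt_dec (Cmod (f m)) (eps / 2)); [lra|]. nra.
Qed.

(** As long as [|B p^m| >= 1], [leading_coef_zero] annihilates one coefficient after another. Some
    [m] has [|B p^m| < 1] because [|p| < 1], and this modulus serves as [rho], since [|B p^n|] does
    not increase with [n]. *)
Lemma nonzero_coefs_contract (c : R) : (0 < c)%R ->
  (forall s, (c <= Cmod (w s))%R) ->
  exists rho, (0 <= rho < 1)%R /\
    forall n, f n = 0 \/ (Cmod (B * p ^ n) <= rho)%R.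
Proof.
  intros Hc Hw.
  assert (H : forall m, (forall j, (j < m)%nat -> f j = 0) \/
    exists rho, (0 <= rho < 1)%R /\ forall n, f n = 0 \/ (Cmod (B * p ^ n) <= rho)%R).
  { assert (Hdone : forall m, (forall j, (j < m)%nat -> f j = 0) ->
      (Cmod (B * p ^ m) < 1)%R ->
      exists rho, (0 <= rho < 1)%R /\
        forall n, f n = 0 \/ (Cmod (B * p ^ n) <= rho)%R).
    { intros m Hz Hm. exists (Cmod (B * p ^ m)). split; [split; [apply Cmod_ge_0|exact Hm]|].
      intros n. destruct (Nat.lt_ge_cases n m) as [Hn|Hn]; [left; auto|right].
      replace n with (m + (n - m))%nat by lia.
      rewrite Cpow_add_r, Cmult_assoc, Cmod_mult, Cmod_pow.
      pose proof (p_pow_le_1 (n - m)). pose proof (Cmod_ge_0 (B * p ^ m)). nra. }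
    induction m as [|m [Hz|Hr]]; [left; intros; lia| |right; exact Hr].
    destruct (Rlt_le_dec (Cmod (B * p ^ m)) 1) as [Hlt|Hge]; [right; eauto|].
    left. intros j Hj. destruct (Nat.eq_dec j m) as [->|Hne]; [|apply Hz; lia].
    exact (leading_coef_zero c m Hc Hw Hz Hge). }
  assert (Hp1 : (0 <= Cmod p < 1)%R) by lra.
  destruct (proj2 (is_lim_seq_spec _ _)
    (lim_scaled_pow (Cmod B) (Cmod p) Hp1) (mkposreal _ Rlt_0_1)) as [m Hm].
  destruct (H m) as [Hz|Hr]; [|exact Hr].
  exists (Cmod (B * p ^ m)).
  assert (Hlt : forall n, (m <= n)%nat -> (Cmod (B * p ^ n) <= Cmod (B * p ^ m))%R).
  { intros n Hn. replace n with (m + (n - m))%nat by lia.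
    rewrite Cpow_add_r, Cmult_assoc, Cmod_mult, Cmod_pow.
    pose proof (p_pow_le_1 (n - m)). pose proof (Cmod_ge_0 (B * p ^ m)). nra. }
  split.
  - split; [apply Cmod_ge_0|]. rewrite Cmod_mult_pow.
    specialize (Hm m (le_n m)). cbn [pos] in Hm. rewrite Rminus_0_r in Hm.
    pose proof (Rle_abs (Cmod B * Cmod p ^ m)). lra.
  - intros n. destruct (Nat.lt_ge_cases n m) as [Hn|Hn]; [left; auto|right; auto].
Qed.

(** A terminating [w] admits any positive ratio below 1, as only finitely many [s] contribute.
    Otherwise the ratio comes from the indices where [f n] is nonzero. *)
Lemma summable_of_term_series :
  (exists N, forall s, (N < s)%nat -> w s = 0) \/
  (exists c, (0 < c)%R /\ forall s, (c <= Cmod (w s))%R) ->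
  exists K rho, (0 <= rho < 1)%R /\
    forall s n, (Cmod (f n * (w s * (B * p ^ n) ^ s)) <= K * rho ^ s * t ^ n)%R.
Proof.
  intros [[N HN]|[c [Hc Hw]]].
  - destruct (finite_max (fun s => Cmod (w s * B ^ s) * 2 ^ s)%R N) as [K [HK HKs]].
    exists (M * K)%R, (/ 2)%R. split; [lra|]. intros s n.
    destruct (Nat.lt_ge_cases N s) as [Hs|Hs].
    { rewrite HN by exact Hs. rewrite Cmult_0_l, Cmult_0_r, Cmod_0.
      repeat apply Rmult_le_pos; auto; apply pow_le; lra. }
    rewrite Cpow_mult_l, Cmult_assoc, Cmult_assoc, Cmod_mult.
    rewrite <- Cmult_assoc, Cmod_mult, !Cmod_pow, <- pow_mult.
    assert (HK2 : (Cmod (w s * B ^ s) <= K * (/ 2) ^ s)%R).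
    { specialize (HKs s Hs). cbv beta in HKs.
      rewrite pow_inv. apply (Rmult_le_reg_r (2 ^ s)); [apply pow_lt; lra|].
      rewrite Rmult_assoc, Rinv_l; [lra|]. apply pow_nonzero. lra. }
    pose proof (p_pow_le_1 (n * s)).
    replace (M * K * (/ 2) ^ s * t ^ n)%R
      with (M * t ^ n * (K * (/ 2) ^ s) * 1)%R by ring.
    apply Rmult_le_compat; try lra.
    + apply Rmult_le_pos; apply Cmod_ge_0.
    + apply Rmult_le_compat; try apply Cmod_ge_0; auto.
  - destruct (nonzero_coefs_contract c Hc Hw) as [rho [Hrho Hn]].
    exists (M * W)%R, rho. split; [exact Hrho|]. intros s n.
    pose proof (w_le O) as HW0. pose proof (Cmod_ge_0 (w O)).
    destruct (Hn n) as [H0|Hle].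
    + rewrite H0, Cmult_0_l, Cmod_0.
      repeat apply Rmult_le_pos; auto; try lra; apply pow_le; lra.
    + rewrite !Cmod_mult, Cmod_pow.
      replace (M * W * rho ^ s * t ^ n)%R with (M * t ^ n * (W * rho ^ s))%R by ring.
      pose proof (Cmod_ge_0 (B * p ^ n)).
      apply Rmult_le_compat; auto using Cmod_ge_0.
      * apply Rmult_le_pos; [apply Cmod_ge_0|apply pow_le; auto].
      * apply Rmult_le_compat; auto using Cmod_ge_0.
        -- apply pow_le; auto.
        -- apply pow_incr; auto.
Qed.

End Summability.

(* The coefficientwise form of the theorem: with [a = C'/B],
   [(B;p)_n / (C';p)_n] is expanded by the q-binomial theorem at [z = B p^n]. *)
Lemma pochhammer_ratio_transform (f F : nat -> C) (a B C' p l : C) (M t : R) :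
  (0 <= t < 1)%R -> (0 < Cmod p < 1)%R ->
  (forall n, (Cmod (f n) <= M * t ^ n)%R) ->
  (forall s, C_series (fun n => f n * (p ^ s) ^ n) (F s)) ->
  a * B = C' -> (forall n, C' * p ^ n <> 1) ->
  C_series (fun s => qbin a p s * B ^ s * F s) l ->
  C_series (fun n => qpoch B p n / qpoch C' p n * f n)
    (qpoch_inf B p / qpoch_inf C' p * l).
Proof.
  intros Ht Hp Hf HF Ha HC Hl.
  destruct Hp as [Hp0 Hp1].
  destruct (qbin_upper a p Hp1) as [W [_ HW]].
  destruct (summable_of_term_series f (qbin a p) F B p l M t W Ht (conj Hp0 Hp1) Hf
    HW HF Hl (qbin_dichotomy a p Hp1)) as [K [rho [Hrho HK]]].
  set (v := fun s n => f n * (qbin a p s * (B * p ^ n) ^ s)).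
  (* The identity is kept free of division by [qpoch_inf B p], which may vanish. Zero coefficients
     are treated apart, because [HK] bounds the q-binomial terms only after division by [|f n|]. *)
  assert (Hex : forall n, exists g, C_series (fun s => v s n) g /\
            qpoch_inf B p * g = qpoch_inf C' p * (qpoch B p n / qpoch C' p n * f n)).
  { intros n. destruct (Ceq_dec (f n) 0) as [H0|H0].
    - exists (RtoC 0). split; [|rewrite H0; ring].
      destruct (geometric_ex_series (fun s => v s n) 0 rho Hrho) as [g Hg].
      { intros s. unfold v. rewrite H0, Cmult_0_l, Cmod_0. lra. }
      replace (RtoC 0) with g; [exact Hg|]. apply Cmod_eq_0, Rle_antisym; [|apply Cmod_ge_0].
      replace 0%R with (0 / (1 - rho))%R by (field; lra).
      apply (geometric_series_le (fun s => v s n)); auto.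
      intros s. unfold v. rewrite H0, Cmult_0_l, Cmod_0. lra.
    - destruct (q_binomial a p Hp1 (B * p ^ n) (K * t ^ n / Cmod (f n)) rho Hrho)
        as [h [Hh Heq]].
      { pose proof (proj1 (Cmod_gt_0 _) H0) as Hpos. intros s.
        apply (Rmult_le_reg_l (Cmod (f n))); [exact Hpos|].
        rewrite <- Cmod_mult. eapply Rle_trans; [apply HK|].
        apply Req_le. field. lra. }
      exists (f n * h). split.
      + exact (is_series_scal (K := C_AbsRing) (V := C_NormedModule) (f n) _ _ Hh).
      (* Splitting [n] factors off both infinite products leaves those at [B p^n] and [C' p^n],
         which the q-binomial theorem relates. *)
      + rewrite (qpoch_inf_add p Hp1 B n), (qpoch_inf_add p Hp1 C' n).
        replace (a * (B * p ^ n)) with (C' * p ^ n) in Heq by (rewrite <- Ha; ring).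
        rewrite <- Heq. field. apply qpoch_neq_0; auto. }
  set (g := fun n => CSeries (fun s => v s n)).
  assert (Hg : forall n, C_series (fun s => v s n) (g n) /\
            qpoch_inf B p * g n = qpoch_inf C' p * (qpoch B p n / qpoch C' p n * f n)).
  { intros n. destruct (Hex n) as [g' [H1 H2]]. unfold g.
    rewrite (CSeries_unique _ _ H1). auto. }
  (* Summing [v] over [n] first gives the given terms with sum [l]; summing over [s] first gives
     [g]. *)
  assert (Hgl : C_series g l).
  { apply (series_fubini v K rho t (fun s => qbin a p s * B ^ s * F s) g l Hrho Ht HK).
    - intros s. eapply is_series_ext;
        [|exact (is_series_scal (K := C_AbsRing) (V := C_NormedModule)
            (qbin a p s * B ^ s) _ _ (HF s))].
      intros n. unfold v.
      change (qbin a p s * B ^ s * (f n * (p ^ s) ^ n)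
              = f n * (qbin a p s * (B * p ^ n) ^ s)).
      rewrite Cpow_mult_l, <- !Cpow_mult_r, (Nat.mul_comm n s). ring.
    - intros n. apply Hg.
    - exact Hl. }
  eapply is_series_ext;
    [|exact (is_series_scal (K := C_AbsRing) (V := C_NormedModule)
        (qpoch_inf B p / qpoch_inf C' p) _ _ Hgl)].
  intros n. change (qpoch_inf B p / qpoch_inf C' p * g n
                    = qpoch B p n / qpoch C' p n * f n).
  pose proof (qpoch_inf_neq_0 p Hp1 C' HC) as HC0.
  replace (qpoch_inf B p / qpoch_inf C' p * g n)
    with (qpoch_inf B p * g n / qpoch_inf C' p) by (field; exact HC0).
  rewrite (proj2 (Hg n)). field. split; [apply qpoch_neq_0; auto|exact HC0].
Qed.

(** * Complex powers through a chosen logarithm *)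

Lemma Cexp_plus (u v : C) : Cexp (u + v) = Cexp u * Cexp v.
Proof.
  destruct u as [u1 u2], v as [v1 v2]. unfold Cexp, Cmult, Cplus. simpl.
  rewrite exp_plus, cos_plus, sin_plus. f_equal; ring.
Qed.

Lemma Cexp_0 : Cexp 0 = 1.
Proof. unfold Cexp. simpl. rewrite exp_0, cos_0, sin_0. unfold RtoC. f_equal; ring. Qed.

Lemma Cexp_INR (z : C) (n : nat) : Cexp (z * INR n) = Cexp z ^ n.
Proof.
  induction n as [|n IH].
  - simpl. rewrite Cmult_0_r. apply Cexp_0.
  - rewrite S_INR, RtoC_plus.
    replace (z * (INR n + 1)) with (z + z * INR n) by ring.
    rewrite Cexp_plus, IH. reflexivity.
Qed.

Lemma Cpower_sub_mul (L a b : C) : Cpower L (a - b) * Cpower L b = Cpower L a.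
Proof. unfold Cpower. rewrite <- Cexp_plus. f_equal. ring. Qed.

Lemma Cpower_mul_INR (L b : C) (n : nat) : Cpower L (b * INR n) = Cpower L b ^ n.
Proof.
  unfold Cpower. rewrite <- Cexp_INR. f_equal. ring.
Qed.

(** Since [Cpower L (- INR n)] is the inverse of [q^n], the condition on exponents takes the form
    used for Pochhammer symbols. *)
Lemma Cpower_neq_neg (L d q : C) : Cexp L = q ->
  (forall n : nat, Cpower L d <> Cpower L (- INR n)) ->
  forall n : nat, Cpower L d * q ^ n <> 1.
Proof.
  intros HL H n Hn. apply (H n).
  assert (E : q ^ n * Cpower L (- INR n) = 1).
  { rewrite <- HL, <- Cexp_INR. unfold Cpower. rewrite <- Cexp_plus, <- Cexp_0.
    f_equal. ring. }
  replace (Cpower L d) with (Cpower L d * (q ^ n * Cpower L (- INR n)))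
    by (rewrite E; ring).
  rewrite Cmult_assoc, Hn. ring.
Qed.

(** * Humbert functions as power series in their last variable *)

Section Humbert.

Variables (A D q p x : C).
Hypothesis q_lt_1 : (Cmod q < 1)%R.
Hypothesis p_lt_1 : (Cmod p < 1)%R.
Hypothesis x_lt_1 : (Cmod x < 1)%R.
Hypothesis D_neq : forall n, D * q ^ n <> 1.

(** The factor common to the terms of [Psi1] and [Psi2]: the power of the last variable and the
    ratio [(B;p)_l / (C';p)_l] are split off. Its sum over [k] is the coefficient [F_l]. *)
Definition humbert_term (l k : nat) : C :=
  qpoch A q (k + l) / (qpoch D q k * qpoch q q k * qpoch p p l) * x ^ k.

Definition humbert_coef (l : nat) : C := CSeries (humbert_term l).

(** Uniformity in [l] comes from the upper bound on [(A;q)_(k+l)], independent of its index, and the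
    lower bounds on the denominators. *)
Lemma humbert_term_le : exists M, (0 <= M)%R /\
  forall l k, (Cmod (humbert_term l k) <= M * Cmod x ^ k)%R.
Proof.
  destruct (qpoch_inv_le q q_lt_1 D D_neq) as [K1 [HK1 H1]].
  destruct (qpoch_inv_le q q_lt_1 q (Cmult_pow_neq_1 q q_lt_1)) as [K2 [HK2 H2]].
  destruct (qpoch_inv_le p p_lt_1 p (Cmult_pow_neq_1 p p_lt_1)) as [K3 [HK3 H3]].
  set (E := exp (Cmod A / (1 - Cmod q))).
  assert (HE : (0 <= E)%R) by (left; apply exp_pos).
  exists (E * (K1 * K2 * K3))%R.
  split; [repeat apply Rmult_le_pos; auto|].
  intros l k. unfold humbert_term.
  replace (qpoch A q (k + l) / (qpoch D q k * qpoch q q k * qpoch p p l))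
    with (qpoch A q (k + l) * (/ qpoch D q k * / qpoch q q k * / qpoch p p l)).
  2:{ field. repeat split; apply qpoch_neq_0; auto using Cmult_pow_neq_1. }
  rewrite !Cmod_mult, Cmod_pow.
  apply Rmult_le_compat_r; [apply pow_le, Cmod_ge_0|].
  apply Rmult_le_compat; [apply Cmod_ge_0| |apply qpoch_upper, q_lt_1|].
  - repeat apply Rmult_le_pos; apply Cmod_ge_0.
  - apply Rmult_le_compat; auto using Cmod_ge_0.
    + apply Rmult_le_pos; apply Cmod_ge_0.
    + apply Rmult_le_compat; auto using Cmod_ge_0.
Qed.

Lemma humbert_coef_series (l : nat) : C_series (humbert_term l) (humbert_coef l).
Proof.
  destruct humbert_term_le as [M [_ HM]].
  destruct (geometric_ex_series (humbert_term l) M (Cmod x)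
              (conj (Cmod_ge_0 x) x_lt_1) (HM l)) as [s Hs].
  unfold humbert_coef. rewrite (CSeries_unique _ _ Hs). exact Hs.
Qed.

Lemma humbert_coef_le : exists M, (0 <= M)%R /\
  forall l, (Cmod (humbert_coef l) <= M)%R.
Proof.
  destruct humbert_term_le as [M [HM HMl]].
  exists (M / (1 - Cmod x))%R. split.
  { apply Rmult_le_pos; [exact HM|left; apply Rinv_0_lt_compat; lra]. }
  intros l. apply (geometric_series_le (humbert_term l) M (Cmod x)
              (conj (Cmod_ge_0 x) x_lt_1) (HMl l) _ (humbert_coef_series l)).
Qed.

(** [beta] is constantly 1 for [Psi2] and the ratio of [p]-Pochhammer symbols for [Psi1], so one
    evaluation by rows serves both. *)
Lemma humbert_double_series (beta : nat -> C) (K : R) (z S : C) :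
  (Cmod z < 1)%R -> (forall l, (Cmod (beta l) <= K)%R) ->
  C_series (fun l => beta l * (humbert_coef l * z ^ l)) S ->
  is_double_series (fun l k => beta l * z ^ l * humbert_term l k) S.
Proof.
  intros Hz Hb HS. destruct humbert_term_le as [M [HM HMl]].
  apply (double_series_of_rows _ (K * M) (Cmod z) (Cmod x)
    (conj (Cmod_ge_0 z) Hz) (conj (Cmod_ge_0 x) x_lt_1))
    with (g := fun l => beta l * (humbert_coef l * z ^ l)).
  - intros l k. rewrite !Cmod_mult, Cmod_pow.
    replace (K * M * Cmod z ^ l * Cmod x ^ k)%R
      with (K * Cmod z ^ l * (M * Cmod x ^ k))%R by ring.
    apply Rmult_le_compat; auto using Cmod_ge_0.
    + apply Rmult_le_pos; [apply Cmod_ge_0|apply pow_le, Cmod_ge_0].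
    + apply Rmult_le_compat_r; [apply pow_le, Cmod_ge_0|apply Hb].
  - intros l.
    replace (beta l * (humbert_coef l * z ^ l))
      with (beta l * z ^ l * humbert_coef l) by ring.
    exact (is_series_scal (K := C_AbsRing) (V := C_NormedModule) (beta l * z ^ l)
             _ _ (humbert_coef_series l)).
  - exact HS.
Qed.

Lemma Psi2_series (z : C) : (Cmod z < 1)%R ->
  C_series (fun l => humbert_coef l * z ^ l) (Psi2 A 0 D q p x z).
Proof.
  intros Hz. destruct humbert_coef_le as [M [HM HMl]].
  destruct (geometric_ex_series (fun l => humbert_coef l * z ^ l) M (Cmod z)
    (conj (Cmod_ge_0 z) Hz)) as [S HS].
  { intros l. rewrite Cmod_mult_pow.
    apply Rmult_le_compat_r; [apply pow_le, Cmod_ge_0|apply HMl]. }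
  replace (Psi2 A 0 D q p x z) with S; [exact HS|].
  symmetry. apply CDouble_series_unique.
  eapply is_double_series_ext;
    [|apply (humbert_double_series (fun _ => 1) 1 z S Hz)].
  - intros l k. unfold humbert_term. rewrite qpoch_zero. field.
    repeat split; apply qpoch_neq_0; auto using Cmult_pow_neq_1.
  - intros _. rewrite Cmod_1. lra.
  - eapply is_series_ext; [|exact HS]. intros l. symmetry. apply Cmult_1_l.
Qed.

Lemma Psi1_eq (B C' y S : C) : (Cmod y < 1)%R -> (forall n, C' * p ^ n <> 1) ->
  C_series (fun l => qpoch B p l / qpoch C' p l * (humbert_coef l * y ^ l)) S ->
  Psi1 A B C' D q p x y = S.
Proof.
  intros Hy HC HS. destruct (qpoch_inv_le p p_lt_1 C' HC) as [K [HK HKl]].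
  apply CDouble_series_unique.
  eapply is_double_series_ext;
    [|apply (humbert_double_series (fun l => qpoch B p l / qpoch C' p l)
               (exp (Cmod B / (1 - Cmod p)) * K) y S Hy)].
  - intros l k. unfold humbert_term. field.
    repeat split; apply qpoch_neq_0; auto using Cmult_pow_neq_1.
  - intros l. unfold Cdiv. rewrite Cmod_mult.
    apply Rmult_le_compat; auto using Cmod_ge_0, qpoch_upper.
  - exact HS.
Qed.

End Humbert.

(** * Expansion of [Psi1] in values of [Psi2] *)

(** For [|p^b| >= 1] the series on the right may diverge, and [CSeries] is then unspecified.
    Convergence is therefore asserted for [|p^b| < 1], and the identity whenever the series
    converges. *)
Theorem theorem2p10 :
  forall (q p log_q log_p x y a b c d : C),
    (0 < Cmod q < 1)%R ->
    (0 < Cmod p < 1)%R ->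
    Cexp log_q = q ->
    Cexp log_p = p ->
    (Cmod x < 1)%R ->
    (Cmod y < 1)%R ->
    (forall n : nat, Cpower log_p c <> Cpower log_p (- INR n)) ->
    (forall n : nat, Cpower log_q d <> Cpower log_q (- INR n)) ->
    let term := fun s : nat =>
      qpoch (Cpower log_p (c - b)) p s * Cpower log_p (b * INR s)
      / qpoch p p s
      * Psi2 (Cpower log_q a) 0 (Cpower log_q d) q p x (p ^ s * y) in
    ((Cmod (Cpower log_p b) < 1)%R ->
       ex_series (K := C_AbsRing) (V := C_NormedModule) term) /\
    (ex_series (K := C_AbsRing) (V := C_NormedModule) term ->
       Psi1 (Cpower log_q a) (Cpower log_p b)
            (Cpower log_p c) (Cpower log_q d) q p x y
       = qpoch_inf (Cpower log_p b) p / qpoch_inf (Cpower log_p c) p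
         * CSeries term).
Proof.
  intros q p log_q log_p x y a b c d [_ Hq] Hp Hlq Hlp Hx Hy Hc Hd term.
  pose proof (proj2 Hp) as Hp1.
  pose proof (Cpower_neq_neg log_p c p Hlp Hc) as HC.
  pose proof (Cpower_neq_neg log_q d q Hlq Hd) as HD.
  set (A := Cpower log_q a) in *. set (B := Cpower log_p b) in *.
  set (D := Cpower log_q d) in *. set (w := Cpower log_p (c - b)) in *.
  set (F := fun s => Psi2 A 0 D q p x (p ^ s * y)).
  set (f := fun l => humbert_coef A D q p x l * y ^ l).
  destruct (humbert_coef_le A D q p x Hq Hp1 Hx HD) as [M [HM HMl]].
  assert (Hf : forall l, (Cmod (f l) <= M * Cmod y ^ l)%R).
  { intros l. unfold f. rewrite Cmod_mult_pow.
    apply Rmult_le_compat_r; [apply pow_le, Cmod_ge_0|apply HMl]. }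
  assert (Hpy : forall s, (Cmod (p ^ s * y) <= Cmod y)%R).
  { intros s. rewrite Cmod_mult, Cmod_pow.
    assert (Cmod p ^ s <= 1)%R by (rewrite <- (pow1 s); apply pow_incr; lra).
    pose proof (Cmod_ge_0 y). nra. }
  (* With [y^l] absorbed into [f], the value at [p^s y] becomes the power series of [f] evaluated at
     [p^s]. *)
  assert (HF : forall s, C_series (fun l => f l * (p ^ s) ^ l) (F s)).
  { intros s. eapply is_series_ext;
      [|apply (Psi2_series A D q p x Hq Hp1 Hx HD (p ^ s * y))].
    - intros l. unfold f. rewrite Cpow_mult_l, (Cmult_comm ((p ^ s) ^ l)). apply Cmult_assoc.
    - specialize (Hpy s). lra. }
  assert (Hterm : forall s, term s = qbin w p s * B ^ s * F s).
  { intros s. unfold term, qbin, F, B. rewrite Cpower_mul_INR. unfold Cdiv. ring. }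
  split.
  - intros HB. destruct (qbin_upper w p Hp1) as [W [HW HWs]].
    (* The values [F s] are bounded by [M / (1 - |y|)] uniformly in [s], so [|p^b|] itself is the
       ratio. *)
    apply (geometric_ex_series term (W * (M / (1 - Cmod y))) (Cmod B)).
    { split; [apply Cmod_ge_0|exact HB]. }
    intros s. rewrite Hterm, !Cmod_mult, Cmod_pow.
    replace (W * (M / (1 - Cmod y)) * Cmod B ^ s)%R
      with (W * Cmod B ^ s * (M / (1 - Cmod y)))%R by ring.
    apply Rmult_le_compat; auto using Cmod_ge_0.
    + apply Rmult_le_pos; [apply Cmod_ge_0|apply pow_le, Cmod_ge_0].
    + apply Rmult_le_compat_r; [apply pow_le, Cmod_ge_0|apply HWs].
    + apply (geometric_series_le _ M (Cmod y) (conj (Cmod_ge_0 y) Hy))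
        with (2 := HF s).
      intros l. rewrite Cmod_mult, !Cmod_pow, <- pow_mult.
      eapply Rle_trans; [|apply (Hf l)]. rewrite <- Rmult_1_r.
      apply Rmult_le_compat_l; [apply Cmod_ge_0|].
      rewrite <- (pow1 (s * l)). apply pow_incr. lra.
  - intros [T HT]. rewrite (CSeries_unique _ _ HT).
    apply (Psi1_eq A D q p x Hq Hp1 Hx HD B (Cpower log_p c) y _ Hy HC).
    apply (pochhammer_ratio_transform f F w B (Cpower log_p c) p T M (Cmod y));
      auto using Cmod_ge_0.
    + unfold w, B. apply Cpower_sub_mul.
    + eapply is_series_ext; [exact Hterm|exact HT].
Qed.
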